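(* Let $N$ be a finite index set, let $X=(X_j)_{j\in N}\in H_N$, and assume that $X$ has the dual $Y=(Y_j)_{j\in N}\in H_N$. Let $K,M\subset N$ and $l\in N$ be such that $K$, $\{l\}$ and $M$ partition $N$, i.e. $N=K\cup\{l\}\cup M$ (disjoint union). Then the following equalities hold: (a) $\displaystyle X_l-\hat X_l(K)=\frac{Y_l-\hat Y_l(M)}{\lVert Y_l-\hat Y_l(M)\rVert^2}$; (b) $\displaystyle \lVert X_l-\hat X_l(K)\rVert=\frac{1}{\lVert Y_l-\hat Y_l(M)\rVert}$.
   Context: Fix a probability space $(\Omega,\mathcal F,P)$. For complex-valued random variables in $L^2(\Omega,\mathcal F,P)$ use the inner product $(U,V):=E[U\overline V]$ and norm $\lVert U\rVert:=E[|U|^2]^{1/2}$. For a finite index set $N$, $H_N$ is the class of vectors $X=(X_j)_{j\in N}$ with $X_j\in L^2(\Omega,\mathcal F,P)$ and $E[X_j]=0$ for all $j\in N$. $\mathrm{sp}$ denotes (complex) linear span, with $\mathrm{sp}\,\emptyset=\{0\}$. Dual: for $X\in H_N$, a random vector $Y\in H_N$ is called the dual of $X$ if (i) $Y_j\in\mathrm{sp}\{X_k;k\in N\}$ for every $j\in N$, and (ii) $X$ and $Y$ are biorthogonal: $(X_i,Y_j)=\delta_{ij}$ for all $i,j\in N$. Predictor: for $Z\in H_N$, $l\in N$ and $K\subset N$, $\hat Z_l(K)$ denotes the orthogonal projection of $Z_l$ onto $\mathrm{sp}\{Z_k;k\in K\}$ (so $\hat X_l(K)$ uses the components of $X$, and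 $\hat Y_l(M)$ those of $Y$). *)

(* Defs.v *)
From HB Require Import structures.
From mathcomp Require Import all_boot all_order all_algebra.
From mathcomp Require Import complex.
From mathcomp Require Import all_classical all_reals all_analysis.

Set Implicit Arguments.
Unset Strict Implicit.
Unset Printing Implicit Defensive.

Import Order.TTheory GRing.Theory Num.Theory.
Import numFieldNormedType.Exports.
Import ComplexField.Normc.

Local Open Scope classical_set_scope.
Local Open Scope complex_scope.
Local Open Scope ring_scope.

Section L2_complex.
Context (d : measure_display) (T : measurableType d) (R : realType).
Variable P : probability T R.
Implicit Types (U V W : T -> R[i]).

Definition cmeasurable U : Prop :=
  measurable_fun [set: T] (fun w => complex.Re (U w)) /\
  measurable_fun [set: T] (fun w => complex.Im (U w)).

(* `normc : R[i] -> R` is the modulus with real values; the norm `|z| of the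
   numeric field R[i] takes values in R[i]. *)
Definition L2c U : Prop :=
  cmeasurable U /\ ('E_P[fun w => (normc (U w) ^+ 2)%R] < +oo)%E.

(* Meaningful for integrable U, in particular for U in L2c and for the product
   of two elements of L2c; `fine` sends infinite values to 0. *)
Definition cexpect U : R[i] :=
  fine ('E_P[fun w => complex.Re (U w)])%E +i*
  fine ('E_P[fun w => complex.Im (U w)])%E.

Definition inner U V : R[i] := cexpect (fun w => U w * conjc (V w)).

Definition L2norm U : R :=
  Num.sqrt (fine ('E_P[fun w => (normc (U w) ^+ 2)%R])%E).

Definition is_orthogonal_projection (S : set (T -> R[i])) U V : Prop :=
  S V /\ forall W, S W -> inner (fun w => U w - V w) W = 0.

Variable N : finType.
Implicit Types (X Y Z : N -> T -> R[i]) (A : {set N}).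

Definition in_HN Z : Prop := forall j, L2c (Z j) /\ cexpect (Z j) = 0.

(* Complex linear span of {Z_k; k in A} as a subset of L^2: it is closed under
   almost sure equality, and for empty A it consists of the square-integrable
   functions that vanish almost surely. *)
Definition sp Z A : set (T -> R[i]) :=
  [set V | L2c V /\
     exists c : N -> R[i], V = (fun w => \sum_(k in A) c k * Z k w) %[ae P]].

Definition is_dual X Y : Prop :=
  [/\ in_HN Y,
      forall j, sp X [set: N]%SET (Y j) &
      forall i j, inner (X i) (Y j) = (i == j)%:R].

(* A representative of the orthogonal projection, which is determined up to
   almost sure equality. The default value 0 is used only if there is no
   orthogonal projection, which does not happen for Z in H_N. *)
Definition predictor Z (l : N) A : T -> R[i] :=
  xget (fun=> 0) [set V | is_orthogonal_projection (sp Z A) (Z l) V].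

Definition pred_error Z (l : N) A : T -> R[i] :=
  fun w => Z l w - predictor Z l A w.

End L2_complex.

(* Main.v *)
Require Import Defs.
From HB Require Import structures.
From mathcomp Require Import all_boot all_order all_algebra.
From mathcomp Require Import complex.
From mathcomp Require Import all_classical all_reals all_analysis.
From mathcomp Require Import measurable_realfun.
From mathcomp Require Import ring lra.

(* Let e = Y_l - Yhat_l(M). By biorthogonality the coefficients of e in terms
   of X are c_j = (e, Y_j): they vanish for j in M, and c_l = (e, e) because e
   is orthogonal to the predictor Yhat_l(M). Moreover (X_k, e) = delta_kl for
   k outside M; the case k = l shows that e is nonzero. Hence X_l - e / c_l is
   a linear combination of the X_k with k in K, and its difference e / c_l to
   X_l is orthogonal to all of these, so it is the predictor Xhat_l(K). *)

Set Implicit Arguments.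
Unset Strict Implicit.
Unset Printing Implicit Defensive.

Import Order.TTheory GRing.Theory Num.Theory.
Import ComplexField.Normc.
Local Open Scope complex_scope.
Local Open Scope ring_scope.

Section complex_L2_theory.
Context (d : measure_display) (T : measurableType d) (R : realType).
Variable P : probability T R.
Implicit Types (U V W : T -> R[i]) (a : R[i]).

(** * Modulus, measurability and square-integrability of complex-valued functions *)

Lemma normc_sqr (z : R[i]) :
  normc z ^+ 2 = complex.Re z ^+ 2 + complex.Im z ^+ 2.
Proof. by case: z => x y; rewrite /= sqr_sqrtr// addr_ge0 ?sqr_ge0. Qed.

Lemma normcJ (z : R[i]) : normc (conjc z) = normc z.
Proof. by case: z => x y; rewrite /= sqrrN. Qed.

Lemma normr_Re_le_normc (z : R[i]) : `|complex.Re z| <= normc z.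
Proof.
by case: z => x y; rewrite /= -sqrtr_sqr ler_wsqrtr// lerDl sqr_ge0.
Qed.

Lemma normr_Im_le_normc (z : R[i]) : `|complex.Im z| <= normc z.
Proof.
by case: z => x y; rewrite /= -sqrtr_sqr ler_wsqrtr// lerDr sqr_ge0.
Qed.

Lemma cmeasurable_cst a : cmeasurable (fun _ : T => a).
Proof. by split; exact: measurable_cst. Qed.

Lemma cmeasurableD U V :
  cmeasurable U -> cmeasurable V -> cmeasurable (fun w => U w + V w).
Proof.
move=> [mU1 mU2] [mV1 mV2]; split.
- rewrite (_ : (fun w => _) = (fun w => complex.Re (U w) + complex.Re (V w))).
    exact: measurable_funD.
  by apply/funext => w; case: (U w) (V w) => [? ?] [].
- rewrite (_ : (fun w => _) = (fun w => complex.Im (U w) + complex.Im (V w))).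
    exact: measurable_funD.
  by apply/funext => w; case: (U w) (V w) => [? ?] [].
Qed.

Lemma cmeasurableM U V :
  cmeasurable U -> cmeasurable V -> cmeasurable (fun w => U w * V w).
Proof.
move=> [mU1 mU2] [mV1 mV2]; split.
- rewrite (_ : (fun w => _) = (fun w => complex.Re (U w) * complex.Re (V w) -
                                        complex.Im (U w) * complex.Im (V w))).
    by apply: measurable_funB; exact: measurable_funM.
  by apply/funext => w; case: (U w) (V w) => [? ?] [].
- rewrite (_ : (fun w => _) = (fun w => complex.Re (U w) * complex.Im (V w) +
                                        complex.Im (U w) * complex.Re (V w))).
    by apply: measurable_funD; exact: measurable_funM.
  by apply/funext => w; case: (U w) (V w) => [? ?] [].
Qed.

Lemma cmeasurableJ U : cmeasurable U -> cmeasurable (fun w => conjc (U w)).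
Proof.
move=> [mU1 mU2]; split.
- rewrite (_ : (fun w => _) = (fun w => complex.Re (U w)))//.
  by apply/funext => w; case: (U w).
- rewrite (_ : (fun w => _) = (fun w => - complex.Im (U w))).
    exact: measurable_funN.
  by apply/funext => w; case: (U w).
Qed.

Lemma measurable_normc_sqr U :
  cmeasurable U -> measurable_fun [set: T] (fun w => normc (U w) ^+ 2).
Proof.
move=> [mU1 mU2]; under eq_fun do rewrite normc_sqr.
by apply: measurable_funD; exact: measurable_funX.
Qed.

(** The integrand is nonnegative, so it equals its own absolute value, and a finite expectation
    amounts to integrability, the form in which domination and linearity apply. *)
Lemma L2cP U : L2c P U <-> cmeasurable U /\
  P.-integrable [set: T] (EFin \o (fun w => normc (U w) ^+ 2)).
Proof.
split=> -[mU iU]; split=> //.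
- apply/integrableP; split.
    by apply/measurable_EFinP; exact: measurable_normc_sqr.
  move: iU; rewrite unlock; congr (_ < _)%E; apply: eq_integral => w _ /=.
  by rewrite ger0_norm ?sqr_ge0.
- move/integrableP: iU => [_]; rewrite unlock; congr (_ < _)%E.
  by apply: eq_integral => w _ /=; rewrite ger0_norm ?sqr_ge0.
Qed.

Definition cintegrable U :=
  P.-integrable [set: T] (EFin \o (fun w => complex.Re (U w))) /\
  P.-integrable [set: T] (EFin \o (fun w => complex.Im (U w))).

(** Domination: the real and imaginary parts of the product are at most |U||V|, hence at most the
    integrable function |U|^2 + |V|^2. *)
Lemma cintegrableM U V :
  L2c P U -> L2c P V -> cintegrable (fun w => U w * conjc (V w)).
Proof.
move=> /L2cP[mU iU] /L2cP[mV iV].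
have [mUV1 mUV2] := cmeasurableM mU (cmeasurableJ mV).
have bound w : normc (U w * conjc (V w)) <=
    normc (U w) ^+ 2 + normc (V w) ^+ 2.
  rewrite normcM normcJ; move: (normc (U w)) (normc (V w)) => x y.
  (* x^2 + y^2 - xy = 3/4 (x - y)^2 + 1/4 (x + y)^2. *)
  have h1 := sqr_ge0 (x - y); have h2 := sqr_ge0 (x + y); nra.
have iUV : P.-integrable [set: T]
    (EFin \o (fun w => normc (U w) ^+ 2 + normc (V w) ^+ 2)).
  exact: (integrableD measurableT iU iV).
have posb w : 0 <= normc (U w) ^+ 2 + normc (V w) ^+ 2.
  by rewrite addr_ge0 ?sqr_ge0.
split; apply: (le_integrable measurableT _ _ iUV);
  do ?[by apply/measurable_EFinP];
  move=> w _ /=; rewrite lee_fin (ger0_norm (posb _)).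
- exact: le_trans (normr_Re_le_normc _) (bound w).
- exact: le_trans (normr_Im_le_normc _) (bound w).
Qed.

Lemma L2cD U V : L2c P U -> L2c P V -> L2c P (fun w => U w + V w).
Proof.
move=> /L2cP[mU iU] /L2cP[mV iV]; apply/L2cP.
have mUV := cmeasurableD mU mV; split => //.
(* The factor 2 comes from |u + v|^2 <= 2 (|u|^2 + |v|^2); the difference of the two sides is |u -
   v|^2. *)
have iUV := integrableZl measurableT 2 (integrableD measurableT iU iV).
apply: (le_integrable measurableT _ _ iUV).
  by apply/measurable_EFinP; exact: measurable_normc_sqr.
move=> w _ /=; rewrite lee_fin (ger0_norm (sqr_ge0 _)) ger0_norm; last first.
  by rewrite mulr_ge0// addr_ge0 ?sqr_ge0.
rewrite !normc_sqr; case: (U w) (V w) => [x y] [z t] /=.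
have h1 := sqr_ge0 (x - z); have h2 := sqr_ge0 (y - t); nra.
Qed.

Lemma L2cZ a U : L2c P U -> L2c P (fun w => a * U w).
Proof.
move=> /L2cP[mU iU]; apply/L2cP; split.
  by apply: cmeasurableM => //; exact: cmeasurable_cst.
under eq_fun do rewrite normcM exprMn.
exact: (integrableZl measurableT (normc a ^+ 2) iU).
Qed.

Lemma L2cB U V : L2c P U -> L2c P V -> L2c P (fun w => U w - V w).
Proof.
move=> hU /(L2cZ (- 1)) hV; under eq_fun do rewrite -mulN1r.
exact: L2cD.
Qed.

Lemma L2c0 : L2c P (fun=> 0).
Proof.
apply/L2cP; split; first exact: cmeasurable_cst.
under eq_fun do rewrite normc0 expr0n.
exact: integrable0.
Qed.

Lemma L2c_sum (I : Type) (s : seq I) (Q : pred I) (c : I -> R[i])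
    (Z : I -> T -> R[i]) : (forall k, L2c P (Z k)) ->
  L2c P (fun w => \sum_(k <- s | Q k) c k * Z k w).
Proof.
move=> hZ; elim: s => [|k s IH].
  by under eq_fun do rewrite big_nil; exact: L2c0.
have [Qk|/negbTE Qk] := boolP (Q k); under eq_fun do rewrite big_cons Qk;
  last exact: IH.
by apply: L2cD => //; exact: L2cZ.
Qed.

(** * Linearity of the complex expectation *)

Lemma cexpectE U : cexpect P U =
  (\int[P]_w complex.Re (U w)) +i* (\int[P]_w complex.Im (U w)).
Proof. by rewrite /cexpect unlock. Qed.

Lemma cexpectD U V : cintegrable U -> cintegrable V ->
  cexpect P (fun w => U w + V w) = cexpect P U + cexpect P V.
Proof.
move=> [U1 U2] [V1 V2]; rewrite !cexpectE.
rewrite (@eq_Rintegral _ _ _ P setT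
    (fun w => complex.Re (U w) + complex.Re (V w))); last first.
  by move=> w _; case: (U w) (V w) => [? ?] [].
rewrite [X in _ +i* X](@eq_Rintegral _ _ _ P setT
    (fun w => complex.Im (U w) + complex.Im (V w))); last first.
  by move=> w _; case: (U w) (V w) => [? ?] [].
by rewrite !RintegralD.
Qed.

Lemma cexpectZ a U : cintegrable U ->
  cexpect P (fun w => a * U w) = a * cexpect P U.
Proof.
move=> [U1 U2]; rewrite !cexpectE; case: a => x y.
have iZ z (f : T -> R) : P.-integrable [set: T] (EFin \o f) ->
    P.-integrable [set: T] (EFin \o (fun w => z * f w)).
  by move=> /(integrableZl measurableT z).
rewrite (@eq_Rintegral _ _ _ P setT
    (fun w => x * complex.Re (U w) - y * complex.Im (U w))); last first.
  by move=> w _; case: (U w).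
rewrite [X in _ +i* X](@eq_Rintegral _ _ _ P setT
    (fun w => x * complex.Im (U w) + y * complex.Re (U w))); last first.
  by move=> w _; case: (U w).
by rewrite RintegralB ?RintegralD ?iZ// !RintegralZl.
Qed.

Lemma cexpectJ U : cintegrable U ->
  cexpect P (fun w => conjc (U w)) = conjc (cexpect P U).
Proof.
move=> [U1 U2]; rewrite !cexpectE /=; congr (_ +i* _).
  by apply: eq_Rintegral => w _; case: (U w).
rewrite -mulN1r -RintegralZl//; apply: eq_Rintegral => w _.
by rewrite mulN1r; case: (U w).
Qed.

(** * Sesquilinearity of the inner product, and the norm it induces *)

Lemma innerDl U V W : L2c P U -> L2c P V -> L2c P W ->
  inner P (fun w => U w + V w) W = inner P U W + inner P V W.
Proof.
move=> hU hV hW; rewrite /inner -cexpectD; do ?exact: cintegrableM.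
by under eq_fun do rewrite mulrDl.
Qed.

Lemma innerZl a U W : L2c P U -> L2c P W ->
  inner P (fun w => a * U w) W = a * inner P U W.
Proof.
move=> hU hW; rewrite /inner -cexpectZ; last exact: cintegrableM.
by under eq_fun do rewrite -mulrA.
Qed.

Lemma innerJ U V : L2c P U -> L2c P V ->
  inner P U V = conjc (inner P V U).
Proof.
move=> hU hV; rewrite /inner -cexpectJ; last exact: cintegrableM.
by congr cexpect; apply/funext => w; rewrite rmorphM /= conjcK mulrC.
Qed.

Lemma innerBl U V W : L2c P U -> L2c P V -> L2c P W ->
  inner P (fun w => U w - V w) W = inner P U W - inner P V W.
Proof.
move=> hU hV hW; rewrite -mulN1r -innerZl// -innerDl//; last exact: L2cZ.
by under [in RHS]eq_fun do rewrite mulN1r.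
Qed.

Lemma innerDr U V W : L2c P U -> L2c P V -> L2c P W ->
  inner P W (fun w => U w + V w) = inner P W U + inner P W V.
Proof.
move=> hU hV hW; rewrite innerJ//; last exact: L2cD.
by rewrite innerDl// rmorphD /= (innerJ hW hU) (innerJ hW hV).
Qed.

Lemma innerZr a U W : L2c P U -> L2c P W ->
  inner P W (fun w => a * U w) = conjc a * inner P W U.
Proof.
move=> hU hW; rewrite innerJ//; last exact: L2cZ.
by rewrite innerZl// rmorphM /= (innerJ hW hU).
Qed.

Lemma innerBr U V W : L2c P U -> L2c P V -> L2c P W ->
  inner P W (fun w => U w - V w) = inner P W U - inner P W V.
Proof.
move=> hU hV hW; rewrite innerJ//; last exact: L2cB.
by rewrite innerBl// rmorphB /= (innerJ hW hU) (innerJ hW hV).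
Qed.

(** Spans and projections are fixed only up to almost sure equality, so the inner product has to
    respect it. *)
Lemma inner_ael U V W : L2c P U -> L2c P V -> L2c P W ->
  U = V %[ae P] -> inner P U W = inner P V W.
Proof.
move=> hU hV hW UV; rewrite /inner !cexpectE.
have [/measurable_int r1 /measurable_int i1] := cintegrableM hU hW.
have [/measurable_int r2 /measurable_int i2] := cintegrableM hV hW.
by congr (_ +i* _); congr fine; apply: ae_eq_integral => //;
  apply: filterS UV => w /(_ I) -> _.
Qed.

Lemma inner_aer U V W : L2c P U -> L2c P V -> L2c P W ->
  U = V %[ae P] -> inner P W U = inner P W V.
Proof.
by move=> hU hV hW UV; rewrite innerJ// (inner_ael hU hV)// (innerJ hW hV).
Qed.

Lemma inner_suml (I : Type) (s : seq I) (Q : pred I) (c : I -> R[i])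
    (Z : I -> T -> R[i]) W : (forall k, L2c P (Z k)) -> L2c P W ->
  inner P (fun w => \sum_(k <- s | Q k) c k * Z k w) W =
  \sum_(k <- s | Q k) c k * inner P (Z k) W.
Proof.
move=> hZ hW; elim: s => [|k s IH].
  rewrite big_nil; under eq_fun do rewrite big_nil.
  (* The empty sum is read as 0 times the zero function, so that homogeneity gives the value 0. *)
  by under eq_fun do rewrite -(mul0r 0); rewrite innerZl ?mul0r//; exact: L2c0.
rewrite big_cons.
have [Qk|/negbTE Qk] := boolP (Q k); under eq_fun do rewrite big_cons Qk;
  last exact: IH.
by rewrite innerDl ?innerZl ?IH//; [exact: L2cZ|exact: L2c_sum].
Qed.

(** Pointwise, the product of u and its conjugate has real part |u|^2 and imaginary part 0. *)
Lemma inner_self U : L2c P U -> inner P U U = (L2norm P U ^+ 2)%:C.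
Proof.
move=> hU; rewrite /L2norm /inner sqr_sqrtr; last first.
  by rewrite fine_ge0// expectation_ge0// => w; rewrite sqr_ge0.
rewrite cexpectE unlock; congr (_ +i* _).
  apply: eq_Rintegral => w _; rewrite normc_sqr; case: (U w) => x y /=.
  by rewrite mulrN opprK.
rewrite (@eq_Rintegral _ _ _ P setT (fun=> 0)).
  by rewrite /Rintegral integral0.
by move=> w _; case: (U w) => x y /=; rewrite mulrN mulrC addNr.
Qed.

Lemma L2norm_eq0 U : L2c P U -> L2norm P U = 0 -> U = (fun=> 0) %[ae P].
Proof.
move=> hU /(congr1 (fun x => x ^+ 2)); rewrite expr0n /= /L2norm sqr_sqrtr.
  move: hU => /L2cP[mU iU]; rewrite unlock => U0.
  pose f := EFin \o (fun w => normc (U w) ^+ 2).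
  have mf : measurable_fun [set: T] f.
    by apply/measurable_EFinP; exact: measurable_normc_sqr.
  have /(ae_eq_integral_abs P measurableT mf) : (\int[P]_w `|f w|)%E = 0%E.
    (* [fine] would also send an infinite expectation to 0; integrability of |U|^2 excludes this. *)
    rewrite -[0%E](congr1 EFin U0) fineK; last exact: integrable_fin_num iU.
    by apply: eq_integral => w _ /=; rewrite ger0_norm ?sqr_ge0.
  apply: filterS => w /(_ I) /= [/eqP].
  by rewrite sqrf_eq0 => /eqP/eq0_normc.
by rewrite fine_ge0// expectation_ge0// => w; rewrite sqr_ge0.
Qed.

Lemma inner_self_eq0 U : L2c P U -> inner P U U = 0 -> U = (fun=> 0) %[ae P].
Proof.
move=> hU; rewrite inner_self// => -[/eqP]; rewrite sqrf_eq0 => /eqP.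
exact: L2norm_eq0.
Qed.

(** * Spans, and existence and uniqueness of orthogonal projections *)

Section span.
Variables (N : finType) (Z : N -> T -> R[i]).
Hypothesis L2Z : forall k, L2c P (Z k).
Implicit Types A B : {set N}.

Lemma sp_gen A j : j \in A -> sp P Z A (Z j).
Proof.
move=> jA; split=> //; exists (fun k => (k == j)%:R); apply: nearW => w _.
rewrite (bigD1 j)//= eqxx mul1r big1 ?addr0// => k /andP[_ /negbTE ->].
by rewrite mul0r.
Qed.

Lemma sp_subset A B V : A \subset B -> sp P Z A V -> sp P Z B V.
Proof.
(* The values of [c] outside [A] are arbitrary, so they are replaced by 0 before the sum is extended
   to [B]. *)
move=> AB [hV [c Vc]]; split=> //; exists (fun k => if k \in A then c k else 0).
apply: filterS Vc => w /(_ I) -> _.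
rewrite big_mkcond [RHS]big_mkcond; apply: eq_bigr => k _.
have [kA|kA] := boolP (k \in A); first by rewrite (fintype.subsetP AB).
by rewrite mul0r if_same.
Qed.

Lemma spD A U V : sp P Z A U -> sp P Z A V -> sp P Z A (fun w => U w + V w).
Proof.
move=> [hU [a Ua]] [hV [b Vb]]; split; first exact: L2cD.
exists (fun k => a k + b k); apply: filterS2 Ua Vb => w /(_ I) -> /(_ I) -> _.
by rewrite -big_split; apply: eq_bigr => k _; rewrite mulrDl.
Qed.

Lemma spZ a A U : sp P Z A U -> sp P Z A (fun w => a * U w).
Proof.
move=> [hU [b Ub]]; split; first exact: L2cZ.
exists (fun k => a * b k); apply: filterS Ub => w /(_ I) -> _.
by rewrite mulr_sumr; apply: eq_bigr => k _; rewrite mulrA.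
Qed.

Lemma spB A U V : sp P Z A U -> sp P Z A V -> sp P Z A (fun w => U w - V w).
Proof.
move=> hU /(spZ (- 1)) hV; under eq_fun do rewrite -mulN1r.
exact: spD.
Qed.

Lemma sp_sum A (I : Type) (s : seq I) (Q : pred I) (c : I -> R[i])
    (X : I -> T -> R[i]) : (forall k, sp P Z A (X k)) ->
  sp P Z A (fun w => \sum_(k <- s | Q k) c k * X k w).
Proof.
move=> spX; elim: s => [|k s IH].
  under eq_fun do rewrite big_nil; split; first exact: L2c0.
  by exists (fun=> 0); apply: nearW => w _; rewrite big1// => k _;
    rewrite mul0r.
have [Qk|/negbTE Qk] := boolP (Q k); under eq_fun do rewrite big_cons Qk;
  last exact: IH.
by apply: spD => //; exact: spZ.
Qed.

Lemma sp_ae A U V : L2c P U -> sp P Z A V -> U = V %[ae P] -> sp P Z A U.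
Proof.
move=> hU [_ [c Vc]] UV; split=> //; exists c.
by apply: filterS2 UV Vc => w /(_ I) -> /(_ I) -> _.
Qed.

(** The linear combination of the [X k] itself lies in the span by [sp_sum]; [V] equals it only
    almost surely, hence [sp_ae]. *)
Lemma sp_trans A B (X : N -> T -> R[i]) V :
  (forall k, sp P Z A (X k)) -> sp P X B V -> sp P Z A V.
Proof. by move=> spX [hV [c Vc]]; apply: sp_ae Vc => //; exact: sp_sum. Qed.

Lemma sp_orthogonal A U W : L2c P W -> sp P Z A U ->
  (forall k, k \in A -> inner P (Z k) W = 0) -> inner P U W = 0.
Proof.
move=> hW [hU [c Uc]] ZW.
rewrite (inner_ael hU (L2c_sum _ _ _ L2Z) hW Uc) inner_suml//.
by rewrite big1// => k kA; rewrite ZW ?mulr0.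
Qed.

Lemma inner_eq0_sym U V : L2c P U -> L2c P V ->
  inner P U V = 0 -> inner P V U = 0.
Proof. by move=> hU hV UV; rewrite innerJ// UV conjc0. Qed.

Lemma sp_orthogonalr A U W : L2c P W -> sp P Z A U ->
  (forall k, k \in A -> inner P W (Z k) = 0) -> inner P W U = 0.
Proof.
move=> hW spU ZW; apply: inner_eq0_sym => //; first exact: spU.1.
by apply: sp_orthogonal spU _ => // k kA; apply: inner_eq0_sym => //; exact: ZW.
Qed.

(* Gram-Schmidt step: the residual [e] of the new generator [Z k] may vanish,
   in which case the junk value [x / 0 = 0] gives the right coefficient. *)
Lemma orthogonal_projection_exists A U : L2c P U ->
  exists V, is_orthogonal_projection P (sp P Z A) U V.
Proof.
(* Induction on the cardinality of [A] with [U] general: the hypothesis is used both for [U] and for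
   the removed generator [Z k]. *)
move: {2}#|A| (erefl #|A|) => n; elim: n A U => [|n IH] A U An hU.
  move/eqP: An; rewrite cards_eq0 => /eqP ->; exists (fun=> 0); split.
    split; first exact: L2c0.
    by exists (fun=> 0); apply: nearW => w _; rewrite big_set0.
  move=> W spW; apply: sp_orthogonalr spW _; first exact: L2cB hU L2c0.
  by move=> k; rewrite inE.
have [k kA] : exists k, k \in A by apply/set0Pn; rewrite -cards_eq0 An.
have A'n : #|A :\ k| = n by move: An; rewrite (cardsD1 k) kA => -[].
have [Vk [spVk oVk]] := IH _ _ A'n (L2Z k).
have [V [spV oV]] := IH _ _ A'n hU.
have sub : A :\ k \subset A by exact: subD1set.
have hV := spV.1; have hVk := spVk.1.
pose e w := Z k w - Vk w.
have he : L2c P e by exact: L2cB.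
have hr : L2c P (fun w => U w - V w) by exact: L2cB.
pose t := inner P (fun w => U w - V w) e / inner P e e.
have te : inner P (fun w => U w - V w) e = t * inner P e e.
  have [e0|e0] := eqVneq (inner P e e) 0; last by rewrite divfK.
  rewrite (inner_aer he L2c0 hr (inner_self_eq0 he e0)) e0 mulr0.
  under [X in inner P _ X]eq_fun do rewrite -(mul0r 0).
  by rewrite innerZr ?conjc0 ?mul0r//; exact: L2c0.
have hte := L2cZ t he.
exists (fun w => V w + t * e w); split.
  apply: spD; first exact: sp_subset spV.
  by apply/spZ/spB; [exact: sp_gen|exact: sp_subset spVk].
move=> W spW; apply: (sp_orthogonalr _ spW); first exact/L2cB/L2cD.
have oj j : j \in A :\ k ->
    inner P (fun w => U w - (V w + t * e w)) (Z j) = 0.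
  move=> jA; under eq_fun do rewrite opprD addrA.
  by rewrite innerBl// oV ?innerZl// ?oVk ?mulr0 ?subr0//; exact: sp_gen.
(* Generators other than [Z k] are orthogonal to both residuals. For [Z k = e + Vk], the part [Vk]
   lies in the span of the others, and [t] is chosen to make the part [e] orthogonal. *)
move=> j jA; have [->|jk] := eqVneq j k; last by apply: oj; rewrite !inE jk.
have -> : Z k = fun w => e w + Vk w by apply/funext => w; rewrite subrK.
have hR : L2c P (fun w => U w - (V w + t * e w)) by exact/L2cB/L2cD.
rewrite innerDr// (sp_orthogonalr hR spVk oj) addr0.
under eq_fun do rewrite opprD addrA.
by rewrite innerBl// innerZl// te subrr.
Qed.

(** The difference [V - W] lies in the span and is also a difference of two residuals, so it is
    orthogonal to itself. *)
Lemma orthogonal_projection_unique A U V W : L2c P U ->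
  is_orthogonal_projection P (sp P Z A) U V ->
  is_orthogonal_projection P (sp P Z A) U W -> V = W %[ae P].
Proof.
move=> hU [spV oV] [spW oW]; have hV := spV.1; have hW := spW.1.
have spVW := spB spV spW; have hVW := spVW.1.
have VWE : (fun w => V w - W w) = fun w => (U w - W w) - (U w - V w).
  by apply/funext => w; ring.
have /inner_self_eq0 : inner P (fun w => V w - W w) (fun w => V w - W w) = 0.
  by rewrite {1}VWE innerBl ?oV ?oW ?subrr//; exact: L2cB.
move=> /(_ hVW); apply: filterS => w /(_ I) VW _.
by apply/eqP; rewrite -subr_eq0 VW.
Qed.

(** Existence of the projection ensures that [xget] does not return its default value. *)
Lemma predictorP l A :
  is_orthogonal_projection P (sp P Z A) (Z l) (predictor P Z l A).
Proof. exact: (xgetPex (fun=> 0) (orthogonal_projection_exists A (L2Z l))). Qed.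

Lemma L2c_pred_error l A : L2c P (pred_error P Z l A).
Proof. by apply: L2cB => //; have [[]] := predictorP l A. Qed.

Lemma pred_error_orthogonal l A W :
  sp P Z A W -> inner P (pred_error P Z l A) W = 0.
Proof. exact: (predictorP l A).2. Qed.

End span.

(** * Homogeneity and almost sure invariance of the norm *)

Lemma L2norm_ge0 U : 0 <= L2norm P U.
Proof. exact: sqrtr_ge0. Qed.

(** Both sides are nonnegative, so it suffices to compare squares, which are inner products; the
    scalar contributes its product with its conjugate, |a|^2. *)
Lemma L2normZ a U : L2c P U ->
  L2norm P (fun w => a * U w) = normc a * L2norm P U.
Proof.
move=> hU; apply/(pexpIrn (n := 2)) => //; rewrite ?nnegrE ?L2norm_ge0//.
  by case: (a) => x y; rewrite mulr_ge0 ?L2norm_ge0//= sqrtr_ge0.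
apply: complexI; rewrite -inner_self; last exact: L2cZ.
rewrite innerZr ?innerZl ?inner_self//; last exact: L2cZ.
rewrite mulrA exprMn [RHS]rmorphM /=; congr (_ * _).
case: (a) => x y; rewrite normc_sqr; apply/eqP; rewrite eq_complex /=.
by apply/andP; split; apply/eqP; ring.
Qed.

Lemma L2norm_ae U V : L2c P U -> L2c P V -> U = V %[ae P] ->
  L2norm P U = L2norm P V.
Proof.
move=> hU hV UV; apply/(pexpIrn (n := 2)); rewrite ?nnegrE ?L2norm_ge0//.
by apply: complexI; rewrite -!inner_self// (inner_ael hU hV)//
  (inner_aer hU hV).
Qed.

End complex_L2_theory.

(** * Prediction errors of a biorthogonal pair *)

Theorem lemma2p4 (d : measure_display) (T : measurableType d) (R : realType)
    (P : probability T R) (N : finType) (X Y : N -> T -> R[i])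
    (K M : {set N}) (l : N)
    (hX : in_HN P X) (hY : is_dual P X Y)
    (hcover : K :|: [set l]%SET :|: M = [set: N]%SET)
    (hKM : [disjoint K & M]) (hlK : l \notin K) (hlM : l \notin M) :
  [/\ L2norm P (pred_error P Y l M) != 0,
      pred_error P X l K =
        (fun w => pred_error P Y l M w
                  / (L2norm P (pred_error P Y l M) ^+ 2)%:C) %[ae P] &
      L2norm P (pred_error P X l K) = 1 / L2norm P (pred_error P Y l M)].
Proof.
have L2X k : L2c P (X k) by have [] := hX k.
have [HNY spY XY] := hY.
have L2Y k : L2c P (Y k) by have [] := HNY k.
pose e := pred_error P Y l M; rewrite -/e.
have he : L2c P e by exact: L2c_pred_error.
have [spYM _] := predictorP L2Y l M; have hYM := spYM.1.
(* The predictor is a combination of the [Y j] with [j] in [M], all orthogonal to [X k], so only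
   (X_k, Y_l) remains. *)
have Xe k : k \notin M -> inner P (X k) e = (k == l)%:R.
  move=> kM; rewrite innerBr// XY (sp_orthogonalr L2Y (L2X k) spYM) ?subr0//.
  by move=> j jM; rewrite XY; case: eqVneq => // kj; rewrite kj jM in kM.
have eM j : j \in M -> inner P e (Y j) = 0.
  by move=> jM; apply: pred_error_orthogonal => //; exact: sp_gen.
pose n := L2norm P e; rewrite -/n.
have eYl : inner P e (Y l) = (n ^+ 2)%:C.
  rewrite -inner_self// [in RHS]/e innerBr//.
  by rewrite (pred_error_orthogonal L2Y l spYM) subr0.
(* Otherwise [e] vanishes almost surely and (X_l, e) would be 0 instead of 1. This makes the
   quotients in the conclusion genuine, since division by 0 returns 0. *)
have n0 : n != 0.
  apply/negP => /eqP /(L2norm_eq0 he) e0.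
  have := Xe l hlM; rewrite (inner_aer he (L2c0 P) (L2X l) e0) eqxx.
  under [X in inner P _ X]eq_fun do rewrite -(mul0r 0).
  rewrite innerZr ?conjc0 ?mul0r//; last exact: L2c0.
  by move/eqP; rewrite eq_sym oner_eq0.
have [_ [c ec]] : sp P X [set: N]%SET e.
  by apply: spB; [exact: spY|exact: sp_trans spYM].
(* Pairing the expansion of [e] with [Y j] isolates one coefficient by biorthogonality. *)
have cE j : c j = inner P e (Y j).
  rewrite (inner_ael he (L2c_sum _ _ _ L2X) (L2Y j) ec) inner_suml//.
  rewrite (bigD1 j) ?inE//= XY eqxx mulr1 big1 ?addr0// => k /andP[_ kj].
  by rewrite XY (negbTE kj) mulr0.
have cl0 : c l != 0.
  by rewrite cE eYl -[0]/(0%:C) (inj_eq (@complexI _)) expf_eq0.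
pose V w := X l w - (c l)^-1 * e w.
have XlV : (fun w => X l w - V w) = fun w => (c l)^-1 * e w.
  by apply/funext => w; rewrite /V opprB addrC subrK.
have hV : L2c P V by apply: L2cB => //; exact: L2cZ.
have projV : is_orthogonal_projection P (sp P X K) (X l) V.
  split.
    (* In X_l - e / c_l the terms in X_l cancel and those with index in [M] have coefficient 0,
       which leaves -c_k / c_l for [k] in [K]. *)
    split=> //; exists (fun k => - ((c l)^-1 * c k)).
    apply: filterS ec => w /(_ I) ew _; rewrite /V ew (bigD1 l) ?inE//=.
    rewrite mulrDr mulrA mulVf// mul1r opprD addrA subrr add0r.
    rewrite mulr_sumr -sumrN big_mkcond [RHS]big_mkcond; apply: eq_bigr => k _.
    rewrite inE /=; have [->|kl] := eqVneq k l; first by rewrite (negbTE hlK).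
    have [kK|kK] := boolP (k \in K); first by rewrite mulNr mulrA.
    have kM : k \in M.
      by have := finset.in_setT k; rewrite -hcover !inE (negbTE kK) (negbTE kl).
    by rewrite (cE k) eM// mul0r mulr0 oppr0.
  move=> W spW; rewrite XlV; apply: (sp_orthogonalr L2X (L2cZ _ he) spW).
  (* An index in [K] is outside [M] and different from [l], so (X_k, e) = 0. *)
  move=> k kK; rewrite innerZl// (inner_eq0_sym (L2X k) he) ?mulr0//.
  have kM : k \notin M by rewrite (disjointFr hKM kK).
  by rewrite Xe//; case: eqVneq => // kl; rewrite -kl kK in hlK.
have clE : c l = (n ^+ 2)%:C by rewrite cE.
have errE : pred_error P X l K = (fun w => (c l)^-1 * e w) %[ae P].
  have := orthogonal_projection_unique (L2X l) (predictorP L2X l K) projV.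
  by apply: filterS => w /(_ I) pV _; rewrite /pred_error pV;
    exact: (congr1 (@^~ w) XlV).
split=> //.
  by apply: filterS errE => w /(_ I) -> _; rewrite clE mulrC.
rewrite (L2norm_ae _ _ errE); [|exact: L2c_pred_error|exact: L2cZ].
(* The scalar 1 / c_l = 1 / n^2 is real and positive, so the norm is n / n^2 = 1 / n. *)
rewrite L2normZ// -/n clE normcV /= expr0n/= addr0 sqrtr_sqr.
rewrite ger0_norm ?sqr_ge0// expr2 invfM -mulrA mulVf// mulr1.
by rewrite div1r.
Qed.
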